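(* Let $d\ge 2$. For every $p\in(0,1)$ there exists a positive integer $K=K(p)$ such that $$\mathbb{P}_p\{\omega\in\Omega:\ S_0(\omega)=\Xi \text{ on } G_K\}>0,$$ where $0$ is the origin of $\mathbb{Z}^d$. Equivalently, $$\mathbb{P}_p\Big(\bigcup_{v\in\mathbb{Z}^d}\{\omega\in\Omega:\ S_v(\omega)=\Xi \text{ on } G_K\}\Big)=1.$$
   Context: Fix $d\ge2$. For an integer $K$, $G_K=(\mathbb{Z}^d,\mathbb{E}_K)$ is the graph with vertex set $\mathbb{Z}^d$ in which $x,y$ are joined by an edge iff there is $i\in\{1,\dots,d\}$ with $0<|x_i-y_i|\le K$ and $x_j=y_j$ for all $j\ne i$. Site percolation: $\Omega=\{0,1\}^{\mathbb{Z}^d}$ with the $\sigma$-algebra generated by cylinder sets, and $\mathbb{P}_p$ is the product measure under which the coordinates $X(v)=X(\omega,v)$, $v\in\mathbb{Z}^d$, are i.i.d. Bernoulli with $\mathbb{P}_p(X(v)=1)=p$, $\mathbb{P}_p(X(v)=0)=1-p$. Words: $\Xi=\{0,1\}^{\mathbb{N}}$ with $\mathbb{N}=\{1,2,\dots\}$; elements $\xi=(\xi_1,\xi_2,\dots)$ are called words. A word $\xi$ is seen in $\omega$ from $v$ on $G_K$ if there is an infinite self-avoiding path $v=v_0,v_1,v_2,\dots$ in $G_K$ (all $v_i$ distinct, consecutive vertices joined by an edge of $G_K$) such that $X(\omega,v_i)=\xi_i$ for all $i\ge1$ (the state of $v_0=v$ is irrelevant). $S_v(\omega)$ denotes the set of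 words $\xi\in\Xi$ seen in $\omega$ from $v$ on $G_K$. *)

(* Defs.v *)
From HB Require Import structures.
From mathcomp Require Import all_boot all_order all_algebra.
From mathcomp Require Import finmap.
From mathcomp Require Import all_classical all_reals all_analysis.

Set Implicit Arguments.
Unset Strict Implicit.
Unset Printing Implicit Defensive.

Import Order.TTheory GRing.Theory Num.Theory.

Local Open Scope classical_set_scope.
Local Open Scope ring_scope.

Definition vertex (d : nat) := {ffun 'I_d -> int}.

Definition origin (d : nat) : vertex d := [ffun=> 0].

Definition adj (d : nat) (K : int) (x y : vertex d) : Prop :=
  exists i : 'I_d, 0 < `|x i - y i| <= K /\ forall j, j != i -> x j = y j.

(* The states 1 and 0 are the booleans true and false. *)
Definition cylinders (d : nat) : set (set (vertex d -> bool)) :=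
  [set C | exists (F : {fset vertex d}) (eta : vertex d -> bool),
     C = [set w | forall v, v \in F -> w v = eta v]].

Definition Omega (d : nat) := g_sigma_algebraType (@cylinders d).

Definition X (d : nat) (v : vertex d) (w : Omega d) : bool := w v.

Definition mutually_independent (d : nat) (R : realType)
    (P : probability (Omega d) R) : Prop :=
  forall (F : {fset vertex d}) (B : vertex d -> set bool),
    P (\bigcap_(v in [set` F]) (X v @^-1` B v)) =
    (\prod_(v <- F) P (X v @^-1` B v))%E.

(* P is the product measure P_p: cylinders, together with the empty set, form
   a generating pi-system, so exactly one P satisfies this when 0 <= p <= 1. *)
Definition bernoulli_product (d : nat) (R : realType) (p : R)
    (P : probability (Omega d) R) : Prop :=
  [/\ mutually_independent P,
      forall v, P [set w | X v w = true] = p%:E &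
      forall v, P [set w | X v w = false] = (1 - p)%:E].

(* Indices are shifted: (xi n) is the letter xi_{n+1} of the word. *)
Definition word := nat -> bool.

Definition self_avoiding_path (d : nat) (K : int) (v : vertex d)
    (gamma : nat -> vertex d) : Prop :=
  [/\ gamma 0%N = v, injective gamma &
      forall n, adj K (gamma n) (gamma n.+1)].

Definition seen (d : nat) (K : int) (v : vertex d) (w : Omega d) (xi : word) :
    Prop :=
  exists2 gamma : nat -> vertex d, self_avoiding_path K v gamma &
    forall n, X (gamma n.+1) w = xi n.

Definition seen_words (d : nat) (K : int) (v : vertex d) (w : Omega d) : set word :=
  [set xi | seen K v w xi].

Definition all_words_seen (d : nat) (K : int) (v : vertex d) : set (Omega d) :=
  [set w | seen_words K v w = [set: word]].

(* Main.v *)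
(* A vertex can be joined to every vertex of its row or column at distance at
   most K.  Tile a quadrant of a coordinate plane by L x L boxes and call a box
   good if each of its rows and columns contains both letters.  From any vertex
   of a box one can step into a good neighbouring box and read there a
   prescribed letter, so an infinite self-avoiding path of good boxes starting
   at the box of the origin makes every word seen, with K = 2L.

   For large L the good boxes percolate by a hierarchical renormalisation: a box
   of level n+1 consists of 3 x 3 boxes of level n and is good if at most one of
   them is bad.  The clusters of neighbouring good boxes are connected to each
   other at every level, and the bad probabilities satisfy
   e(n+1) <= 81 e(n)^2, hence have a small sum.

   By Koenig's lemma, "all words are seen from v" is the decreasing limit of
   the events A(v, n) that all words are seen up to length n, which depend on
   finitely many vertices.  If its probability c is positive, then m far apart
   translates of A(0, n) are independent, so no vertex sees all words with
   probability at most (1 - c)^m + m (P(A(0, n)) - c); let n, then m, tend to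
   infinity. *)
Require Import Defs.
From mathcomp Require Import all_boot all_order all_algebra.
From mathcomp Require Import finmap zify ring lra.
From mathcomp Require Import all_classical all_reals all_analysis.
Set Implicit Arguments.
Unset Strict Implicit.
Unset Printing Implicit Defensive.
Import Order.TTheory GRing.Theory Num.Theory numFieldNormedType.Exports.

(** * Hierarchical renormalisation of site configurations *)

Definition site := (nat * nat)%type.

Definition nbr : rel site := fun a b =>
  ((a.1 == b.1) && ((a.2.+1 == b.2) || (b.2.+1 == a.2))) ||
  ((a.2 == b.2) && ((a.1.+1 == b.1) || (b.1.+1 == a.1))).

Lemma nbrC (a b : site) : nbr a b = nbr b a.
Proof.
rewrite /nbr (eq_sym a.1) (eq_sym a.2) (orbC (a.2.+1 == _)).
by rewrite (orbC (a.1.+1 == _)).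
Qed.

(** Only the target of a step has to satisfy [g], so the start of a path is unconstrained. This is
    why reversing a path in [conn_sym] asks for [g a]. *)
Definition step (g : pred site) : rel site := fun a b => nbr a b && g b.

Definition conn (g : pred site) (a b : site) : Prop :=
  exists2 s, path (step g) a s & last a s = b.

Lemma conn_refl (g : pred site) (a : site) : conn g a a.
Proof. by exists [::]. Qed.

Lemma conn_trans (g : pred site) (b a c : site) :
  conn g a b -> conn g b c -> conn g a c.
Proof.
move=> [s ps <-] [t pt <-]; exists (s ++ t); last by rewrite last_cat.
by rewrite cat_path ps.
Qed.

Lemma conn1 (g : pred site) (a b : site) : nbr a b -> g b -> conn g a b.
Proof. by move=> ab gb; exists [:: b]; rewrite //= /step ab gb. Qed.

Lemma conn_sym (g : pred site) (a b : site) : g a -> conn g a b -> conn g b a.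
Proof.
move=> ga [s]; elim: s a ga => [a _ _ <-|c s IH a ga /= /andP[/andP[ac gc] ps] sb].
  exact: conn_refl.
by apply: conn_trans (IH c gc ps sb) _; apply: conn1; rewrite // nbrC.
Qed.

Definition children (B : site) : seq site :=
  [seq (3 * B.1 + a, 3 * B.2 + b) | a <- iota 0 3, b <- iota 0 3].

(** The formulation by pairs makes failure a finite union, over pairs of distinct children, of the
    events that both are bad. *)
Definition at_most_one_bad (h : pred site) (B : site) : bool :=
  all (fun c => all (fun c' => [|| c == c', h c | h c']) (children B)) (children B).

Fixpoint good (g : pred site) (n : nat) (B : site) : bool :=
  if n is m.+1 then at_most_one_bad (good g m) B else g B.

(** A site belongs to the cluster when every box strictly below [B] on the way down to it is good;
    [B] itself is not tested. *)
Fixpoint cluster (g : pred site) (n : nat) (B : site) : pred site := fun x =>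
  if n is m.+1 then has (fun c => good g m c && cluster g m c x) (children B)
  else x == B.

(** Coordinates relative to the corner child of [B]. They also reach the children of adjacent boxes,
    which turns connectivity into a finite check independent of [B]. *)
Definition shift (B c : site) : site := (3 * B.1 + c.1, 3 * B.2 + c.2).

Lemma childrenE (B : site) : children B = [seq shift B c | c <- children (0, 0)].
Proof. by []. Qed.

Lemma children_shift (B D : site) :
  children (B.1 + D.1, B.2 + D.2) = [seq shift B c | c <- children D].
Proof. by rewrite /children /shift /= !mulnDr -!addnA. Qed.

Lemma nbr_shift (B c c' : site) : nbr (shift B c) (shift B c') = nbr c c'.
Proof. by rewrite /nbr /shift /= -!addnS !eqn_add2l. Qed.

Lemma shift_inj (B : site) : injective (shift B).
Proof. by move=> [a b] [c e] [] /addnI -> /addnI ->. Qed.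

(* The position (9, 9) lies outside the patches checked below and encodes that
   no child is bad. *)
Definition bad_positions (D : site) : seq site := rcons (children D) (9, 9).

(** One round of breadth-first search inside [V]. *)
Definition grow (V acc : seq site) : seq site :=
  [seq v <- V | (v \in acc) || has (nbr^~ v) acc].

(* The patches have at most 18 sites, so 18 rounds reach a whole component. *)
Definition connected_patch (V : seq site) : bool :=
  all (mem (iter 18 (grow V) (take 1 V))) V.

Lemma grow_conn (h : pred site) (B c : site) (V : seq site) (k : nat) :
  {in V, forall v, h (shift B v)} -> c \in V ->
  {in iter k (grow V) [:: c], forall v, h (shift B v) /\ conn h (shift B c) (shift B v)}.
Proof.
move=> hV cV; elim: k => [v|k IH v] /=.
  by rewrite inE => /eqP->; split; [exact: hV|exact: conn_refl].
rewrite mem_filter => /andP[/orP[/IH//|/hasP[u /IH[hu cu] uv] vV]].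
split; first exact: hV.
by apply: conn_trans cu _; apply: conn1; rewrite ?nbr_shift// hV.
Qed.

Lemma connected_patchP (h : pred site) (B : site) (V : seq site) :
  connected_patch V -> {in V, forall v, h (shift B v)} ->
  {in V &, forall u v, conn h (shift B u) (shift B v)}.
Proof.
(* Soundness holds for any number of rounds; generalising 18 keeps the iteration from unfolding. *)
rewrite /connected_patch; move: 18 => k.
case: V => [//|c V]; rewrite [take 1 _]/= take0 => /allP cp hV u v uV vV.
have cV : c \in c :: V by rewrite mem_head.
have [_ cu] := grow_conn hV cV (cp u uV).
have [_ cv] := grow_conn hV cV (cp v vV).
by apply: conn_trans cv; apply: conn_sym cu; exact: hV.
Qed.

(** A single position [b] encodes the whole pattern of good and bad children, so that only finitely
    many patterns have to be checked. *)
Lemma at_most_one_badP (h : pred site) (B D : site) :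
  at_most_one_bad h (B.1 + D.1, B.2 + D.2) ->
  exists2 b, b \in bad_positions D &
    {in children D, forall c, c != (9, 9) -> h (shift B c) = (c != b)}.
Proof.
rewrite /at_most_one_bad children_shift => /allP am.
have [/allP all_good|/allPn[b bD hb]] :=
  boolP (all (fun c => h (shift B c)) (children D)).
  exists (9, 9) => [|c cD ->]; first by rewrite mem_rcons mem_head.
  by rewrite all_good.
exists b => [|c cD _]; first by rewrite mem_rcons inE bD orbT.
have [->|cb] := eqVneq c b; first exact/negbTE.
have /allP/(_ (shift B c)) := am _ (map_f (shift B) bD).
by rewrite map_f// (negbTE hb) (inj_eq (@shift_inj B)) eq_sym (negbTE cb) /= => ->.
Qed.

(** Deleting one site leaves a 3 x 3 square connected. *)
Lemma patch_check1 :
  all (fun b => connected_patch [seq c <- children (0, 0) | c != b])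
      (bad_positions (0, 0)).
Proof. by vm_compute. Qed.

(** Three pairs of sites face each other across the common side of two squares, and one deletion in
    each square destroys at most two of these pairs. *)
Lemma patch_check2 :
  all (fun D => all (fun b => all (fun b' =>
      connected_patch ([seq c <- children (0, 0) | c != b] ++
                       [seq c <- children D | c != b']))
    (bad_positions D)) (bad_positions (0, 0))) [:: (1, 0); (0, 1)].
Proof. by vm_compute. Qed.

Lemma conn_children (h : pred site) (B D : site) :
  D \in [:: (0, 0); (1, 0); (0, 1)] ->
  at_most_one_bad h B -> at_most_one_bad h (B.1 + D.1, B.2 + D.2) ->
  forall c c', c \in children B -> c' \in children (B.1 + D.1, B.2 + D.2) ->
  h c -> h c' -> conn h c c'.
Proof.
move=> D3 aB aD c c'.
have {}aB : at_most_one_bad h (B.1 + 0, B.2 + 0) by rewrite !addn0 -surjective_pairing.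
have [b b0 hb] := @at_most_one_badP h B (0, 0) aB.
have [b' b'D hb'] := at_most_one_badP aD.
rewrite childrenE children_shift => /mapP[x x0 ->] /mapP[y yD ->].
(* No actual child sits at the dummy position, so the side condition of [at_most_one_badP] always
   holds. *)
have noX : all (fun E => all (predC1 (9, 9)) (children E)) [:: (0, 0); (1, 0); (0, 1)].
  by [].
have n0 v : v \in children (0, 0) -> v != (9, 9).
  exact: (allP (allP noX (0, 0) isT)).
have nD v : v \in children D -> v != (9, 9).
  exact: (allP (allP noX D D3)).
rewrite hb ?n0// hb' ?nD// => xb yb'.
(* For a zero offset [b] and [b'] describe the same box; that [y] differs from [b] is then recovered
   through [h]. *)
have [D0|Dn0] := eqVneq D (0, 0).
  subst D; have /allP/(_ _ b0) := patch_check1.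
  move/connected_patchP => /(_ h B); apply.
  - by move=> v; rewrite mem_filter => /andP[vb v0]; rewrite hb ?n0.
  - by rewrite mem_filter xb.
  - rewrite mem_filter yD andbT.
    by rewrite -hb ?n0// hb' ?n0.
have D2 : D \in [:: (1, 0); (0, 1)].
  by move: D3; rewrite !inE (negbTE Dn0).
have /allP/(_ _ D2)/allP/(_ _ b0)/allP/(_ _ b'D) := patch_check2.
move/connected_patchP => /(_ h B); apply.
- move=> v; rewrite mem_cat !mem_filter => /orP[] /andP[vb vD].
    by rewrite hb ?n0.
  by rewrite hb' ?nD.
- by rewrite mem_cat mem_filter xb x0.
- by rewrite mem_cat !mem_filter yb' yD orbT.
Qed.

(** Of any two distinct children one is good; descend into it. *)
Lemma cluster_neq0 (g : pred site) (n : nat) (B : site) :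
  good g n B -> exists x, cluster g n B x.
Proof.
elim: n B => [|n IH] B; first by exists B; rewrite /=.
move=> /allP am.
have c0 : (3 * B.1 + 0, 3 * B.2 + 0) \in children B by rewrite !inE eqxx.
have c1 : (3 * B.1 + 0, 3 * B.2 + 1) \in children B by rewrite !inE eqxx ?orbT.
have /allP/(_ _ c1)/or3P[/eqP[]|g0|g1] := am _ c0.
- lia.
- have [x xc] := IH _ g0.
  by exists x; apply/hasP; eexists; [exact: c0|apply/andP; split].
- have [x xc] := IH _ g1.
  by exists x; apply/hasP; eexists; [exact: c1|apply/andP; split].
Qed.

(** Up to exchanging the boxes, the second one is equal to, right of or above the first; this leaves
    only the offsets covered by the finite checks. *)
Lemma nbr_offset (B B' : site) : B = B' \/ nbr B B' ->
  exists2 D, D \in [:: (0, 0); (1, 0); (0, 1)] &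
    B' = (B.1 + D.1, B.2 + D.2) \/ B = (B'.1 + D.1, B'.2 + D.2).
Proof.
move: B B' => [a b] [a' b']; rewrite /nbr /=.
move=> [[<- <-]|/orP[] /andP[/eqP<- /orP[]/eqP<-]].
- by exists (0, 0) => //; left; rewrite /= !addn0.
- by exists (0, 1) => //; left; rewrite /= addn0 addn1.
- by exists (0, 1) => //; right; rewrite /= addn0 addn1.
- by exists (1, 0) => //; left; rewrite /= addn0 addn1.
- by exists (1, 0) => //; right; rewrite /= addn0 addn1.
Qed.

(** Induction on the level: [conn_children] gives a chain of good children, and the induction
    hypothesis connects the clusters of consecutive ones. *)
Lemma conn_cluster (g : pred site) (n : nat) (B B' : site) :
  good g n B -> good g n B' -> B = B' \/ nbr B B' ->
  forall x y, cluster g n B x -> cluster g n B' y -> conn g x y.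
Proof.
elim: n B B' => [|n IH] B B' gB gB' BB' x y.
  move=> /eqP-> /eqP->; case: BB' => [<-|BB']; first exact: conn_refl.
  exact: conn1.
move=> /hasP[c cB /andP[gc xc]] /hasP[c' cB' /andP[gc' yc']].
(* A chain of good boxes becomes a connection between sites by picking a point in the nonempty
   cluster of each box. *)
have lift s u : path (step (good g n)) u s -> good g n u ->
    forall x y, cluster g n u x -> cluster g n (last u s) y -> conn g x y.
  elim: s u => [|v s IHs] u /=; first by move=> _ gu ? ?; apply: IH => //; left.
  move=> /andP[/andP[uv gv] pv] gu x1 y1 x1u y1s.
  have [z zv] := cluster_neq0 gv.
  by apply: conn_trans (IHs v pv gv z y1 zv y1s); apply: IH x1u zv => //; right.
suff [s ps sc'] : conn (good g n) c c'.
  by apply: (lift _ _ ps gc x y xc); rewrite sc'.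
have [D D3 [B'E|BE]] := nbr_offset BB'.
  by apply: (@conn_children _ B D) => //; rewrite -B'E.
apply: (conn_sym gc').
by apply: (@conn_children _ B' D) => //; rewrite -BE.
Qed.

Lemma cluster_ge (g : pred site) (n : nat) (B x : site) :
  cluster g n B x -> 3 ^ n * B.1 <= x.1 /\ 3 ^ n * B.2 <= x.2.
Proof.
elim: n B => [|n IH] B; first by move=> /eqP->; rewrite expn0 !mul1n.
move=> /hasP[c cB /andP[_ /IH[x1 x2]]].
have [c1 c2] : 3 * B.1 <= c.1 /\ 3 * B.2 <= c.2.
  by move: cB => /allpairsP[[a b] [_ _ ->]] /=; rewrite !leq_addr.
by rewrite expnSr -!mulnA; split;
  [apply: leq_trans x1|apply: leq_trans x2]; rewrite leq_mul2l ?c1 ?c2 orbT.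
Qed.

Lemma path_step_leq (g : pred site) (s : seq site) (a : site) :
  path (step g) a s ->
  (last a s).1 + (last a s).2 <= a.1 + a.2 + size s.
Proof.
elim: s a => [a _|b s IH a] /=; first by rewrite addn0.
move=> /andP[/andP[ab _] /IH]; move: ab; rewrite /nbr.
by move=> /orP[] /andP[/eqP + /orP[]/eqP]; lia.
Qed.

Lemma cluster_origin (g : pred site) (n : nat) :
  (forall k, k <= n -> good g k (0, 0)) -> cluster g n (0, 0) (0, 0).
Proof.
elim: n => [//|n IH] gk; apply/hasP; exists (0, 0); first by rewrite inE.
by apply/andP; split; [exact: gk|apply: IH => k kn; apply: gk; exact: leqW].
Qed.

(** One of the corner children (2, 0) and (0, 2) is good. Its cluster has coordinate sum at least
    [2 * 3 ^ n] and is connected to the origin; since a step raises the sum by at most one, the path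
    is long even after its loops are removed. *)
Lemma good_long_path (g : pred site) (n : nat) :
  (forall k, k <= n.+1 -> good g k (0, 0)) ->
  exists s, [/\ path (step g) (0, 0) s, uniq ((0, 0) :: s) & n <= size s].
Proof.
move=> gk.
have [c [cB gc nc]] : exists c, [/\ c \in children (0, 0), good g n c & 2 <= c.1 + c.2].
  have /allP am := gk n.+1 (leqnn _).
  have cA : (2, 0) \in children (0, 0) by [].
  have cB : (0, 2) \in children (0, 0) by [].
  have /allP/(_ _ cB)/or3P[//|g0|g1] := am _ cA.
    by exists (2, 0).
  by exists (0, 2).
have [y yc] := cluster_neq0 gc.
have yB : cluster g n.+1 (0, 0) y by apply/hasP; exists c; rewrite ?gc.
have [s ps sy] : conn g (0, 0) y.
  apply: (@conn_cluster _ n.+1 (0, 0) (0, 0)); rewrite ?gk//; first by left.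
  exact: cluster_origin.
have [y1 y2] := cluster_ge yc.
move: sy; case/shortenP: ps => s' ps' us' _ sy.
exists s'; split=> //.
have := path_step_leq ps'; rewrite sy /= !add0n; apply: leq_trans.
have n3 : n < 3 ^ n by exact: ltn_expl.
have : 3 ^ n * (c.1 + c.2) <= y.1 + y.2 by rewrite mulnDr leq_add.
by apply: leq_trans; apply: (leq_trans (ltnW n3)); apply: leq_pmulr; lia.
Qed.

(** The quotients by [3 ^ n] say that [x] lies in the box [B] of level [n]. This locality is the
    source of independence between boxes. *)
Lemma good_ext (g g' : pred site) (n : nat) (B : site) :
  (forall x, x.1 %/ 3 ^ n = B.1 -> x.2 %/ 3 ^ n = B.2 -> g x = g' x) ->
  good g n B = good g' n B.
Proof.
elim: n B => [B gg|n IH B gg] /=; first by apply: gg; rewrite expn0 divn1.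
have ch c : c \in children B -> good g n c = good g' n c.
  move=> cB; apply: IH => x x1 x2; apply: gg; rewrite expnSr divnMA ?x1 ?x2.
    move: cB => /allpairsP[[a b] [+ _ ->]] /=; rewrite mem_iota => /andP[_ a3].
    by rewrite mulnC divnMDl// divn_small ?addn0.
  move: cB => /allpairsP[[a b] [_ + ->]] /=; rewrite mem_iota => /andP[_ a3].
  by rewrite mulnC divnMDl// divn_small ?addn0.
rewrite /at_most_one_bad; apply: eq_in_all => c cB; apply: eq_in_all => c' cB'.
by rewrite !ch.
Qed.

Local Open Scope classical_set_scope.
Local Open Scope ring_scope.

(** * Real-valued probabilities and local events *)

Definition pr (d : measure_display) (T : measurableType d) (R : realType)
  (P : probability T R) (E : set T) : R := fine (P E).

Section RealProbability.
Context (d : measure_display) (T : measurableType d) (R : realType).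
Context (P : probability T R).
Implicit Types A B E : set T.

Lemma prE E : measurable E -> P E = (pr P E)%:E.
Proof. by move=> mE; rewrite /pr fineK// fin_num_measure. Qed.

Lemma pr_ge0 E : 0 <= pr P E.
Proof. by rewrite /pr fine_ge0. Qed.

Lemma pr_le1 E : measurable E -> pr P E <= 1.
Proof. by move=> mE; rewrite -lee_fin -prE// probability_le1. Qed.

Lemma pr_setT : pr P setT = 1.
Proof. by rewrite /pr probability_setT. Qed.

Lemma le_pr A B : measurable A -> measurable B -> A `<=` B -> pr P A <= pr P B.
Proof. by move=> mA mB AB; rewrite -lee_fin -!prE// le_measure ?inE. Qed.

Lemma prU A B : measurable A -> measurable B -> A `&` B = set0 ->
  pr P (A `|` B) = pr P A + pr P B.
Proof.
move=> mA mB AB; apply: EFin_inj.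
by rewrite EFinD -!prE ?measureU//; exact: measurableU.
Qed.

Lemma le_prU A B : measurable A -> measurable B ->
  pr P (A `|` B) <= pr P A + pr P B.
Proof.
move=> mA mB; rewrite -lee_fin EFinD -!prE ?measureU2//; exact: measurableU.
Qed.

Lemma prC A : measurable A -> pr P (~` A) = 1 - pr P A.
Proof.
move=> mA; apply: EFin_inj.
by rewrite EFinB -!prE ?probability_setC//; exact: measurableC.
Qed.

Lemma prD A B : measurable A -> measurable B -> B `<=` A ->
  pr P (A `\` B) = pr P A - pr P B.
Proof.
move=> mA mB BA; have mAB : measurable (A `\` B) by exact: measurableD.
rewrite -[in RHS](setDUK BA) prU//; first by rewrite addrAC subrr add0r.
by rewrite setDE setICA setICr setI0.
Qed.

Lemma exists_seq_cons (I : eqType) (i : I) (s : seq I) (F : I -> set T) :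
  [set w | exists2 j, j \in i :: s & F j w] =
  F i `|` [set w | exists2 j, j \in s & F j w].
Proof.
apply/seteqP; split=> [w [j]|w [Fi|[j js Fj]]] /=.
- by rewrite inE => /predU1P[->|js] Fj; [left|right; exists j].
- by exists i; rewrite ?mem_head.
- by exists j; rewrite // inE js orbT.
Qed.

Lemma measurable_exists_seq (I : eqType) (s : seq I) (F : I -> set T) :
  (forall i, measurable (F i)) -> measurable [set w | exists2 i, i \in s & F i w].
Proof.
move=> mF; elim: s => [|i s IH]; last by rewrite exists_seq_cons; exact: measurableU.
by rewrite (_ : [set _ | _] = set0)//; apply/seteqP; split=> // w [].
Qed.

Lemma le_pr_exists_seq (I : eqType) (s : seq I) (F : I -> set T) (f : I -> R) :
  (forall i, measurable (F i)) -> (forall i, i \in s -> pr P (F i) <= f i) ->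
  pr P [set w | exists2 i, i \in s & F i w] <= \sum_(i <- s) f i.
Proof.
move=> mF; elim: s => [|i s IH] Ff.
  rewrite (_ : [set _ | _] = set0); last by apply/seteqP; split=> // w [].
  by rewrite /pr measure0 big_nil.
rewrite exists_seq_cons big_cons.
apply: le_trans (le_prU (mF i) (measurable_exists_seq s mF)) _.
rewrite lerD ?Ff ?mem_head// IH// => j js.
by rewrite Ff// inE js orbT.
Qed.

Lemma pr_bigcap_cvg (F : nat -> set T) : (forall n, measurable (F n)) ->
  (forall n, F n.+1 `<=` F n) -> pr P (F n) @[n --> \oo] --> pr P (\bigcap_n F n).
Proof.
move=> mF FS; have mI : measurable (\bigcap_n F n) by exact: bigcap_measurable.
have Fn : {homo F : n m / (n <= m)%N >-> (m <= n)%O}.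
  move=> n m nm; apply/subsetPset; elim: m nm => [|m IH].
    by rewrite leqn0 => /eqP->.
  rewrite leq_eqVlt => /predU1P[->//|]; rewrite ltnS => /IH.
  by apply: subset_trans; exact: FS.
have F0 : (P (F 0%N) < +oo)%E by rewrite prE// ltry.
have : P \o F @ \oo --> (pr P (\bigcap_n F n))%:E.
  by rewrite -prE//; exact: nonincreasing_cvg_mu.
by move/fine_cvg.
Qed.

End RealProbability.

(** * Events depending on finitely many vertices *)

Section LocalEvents.
Context (d : nat).
Implicit Types (s t : seq (vertex d)) (v : vertex d) (E : set (Omega d)).
Implicit Types (eta : vertex d -> bool).

Definition determined s E : Prop :=
  forall w w' : Omega d, {in s, forall v, X v w = X v w'} -> E w -> E w'.

Definition cyl s eta : set (Omega d) := [set w | {in s, forall v, X v w = eta v}].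

Lemma determinedC s E : determined s E -> determined s (~` E).
Proof. by move=> sE w w' ww' nE /(sE w' w) Ew; apply: nE; apply: Ew => v /ww'. Qed.

Lemma determinedI s t E E' : determined s E -> determined t E' ->
  determined (s ++ t) (E `&` E').
Proof.
move=> sE tE w w' ww' [Ew E'w]; split.
  by apply: sE Ew => v vs; apply: ww'; rewrite mem_cat vs.
by apply: tE E'w => v vs; apply: ww'; rewrite mem_cat vs orbT.
Qed.

(* E is a finite disjoint union of cylinders over the vertices of s. *)
Lemma determined_ind (Q : set (Omega d) -> Prop) s E :
  Q set0 -> (forall A B, A `&` B = set0 -> Q A -> Q B -> Q (A `|` B)) ->
  (forall t eta, t =i s -> Q (cyl t eta)) -> determined s E -> Q E.
Proof.
move=> Q0 QU Qc sE.
(* The letters on [t] are already fixed by [eta], those on [r] are still free. Once [r] is empty,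
   the cylinder is contained in [E] or disjoint from it. *)
suff IH r t eta : r ++ t =i s -> Q (E `&` cyl t eta).
  have := IH s [::] (fun=> true); rewrite cats0 => /(_ (fun=> erefl)).
  by rewrite (_ : cyl _ _ = setT) ?setIT//; apply/seteqP; split.
elim: r t eta => [|v r IH] t eta rt.
  have [[w0 [Ew0 cw0]]|noE] := pselect (exists w, (E `&` cyl t eta) w).
    rewrite setIidr; first exact: Qc.
    move=> w cw; apply: sE Ew0 => v; rewrite -rt /= => vt.
    by rewrite (cw0 _ vt) (cw _ vt).
  rewrite (_ : _ `&` _ = set0)//.
  by apply/seteqP; split=> // w Ew; apply: noE; exists w.
have rvt : r ++ (v :: t) =i s by move=> u; rewrite -rt !(mem_cat, inE) orbCA orbA.
have [vt|vt] := boolP (v \in t).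
  rewrite (_ : cyl t eta = cyl (v :: t) eta); first exact: IH.
  apply/seteqP; split=> w cw u; last by move=> ut; apply: cw; rewrite inE ut orbT.
  by rewrite inE => /predU1P[->|]; exact: cw.
pose up b u := if u == v then b else eta u.
have cylE b w : cyl (v :: t) (up b) w <-> X v w = b /\ cyl t eta w.
  split=> [cw|[vw cw] u].
    split; first by rewrite cw ?mem_head// /up eqxx.
    move=> u ut; rewrite cw ?inE ?ut ?orbT// /up.
    by case: eqP => // uv; move: vt; rewrite -uv ut.
  rewrite inE /up; case: eqP => [->//|_] /= ut; exact: cw.
rewrite (_ : _ `&` _ = (E `&` cyl (v :: t) (up true)) `|` (E `&` cyl (v :: t) (up false))).
  apply: QU; [|exact: IH..].
  by apply/seteqP; split=> // w [[_ /cylE[vw _]] [_ /cylE[+ _]]]; rewrite vw.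
rewrite -setIUr; congr (_ `&` _); apply/seteqP; split=> w.
  by move=> cw; case vw : (X v w); [left|right]; apply/cylE.
by case=> /cylE[].
Qed.

Lemma measurable_cyl s eta : measurable (cyl s eta).
Proof.
apply: sub_sigma_algebra; exists [fset v in s]%fset, eta.
by apply/seteqP; split=> w cw v vs; apply: cw; move: vs; rewrite inE.
Qed.

Lemma measurable_determined s E : determined s E -> measurable E.
Proof.
apply: determined_ind => //; first by move=> A B _; exact: measurableU.
by move=> t eta _; exact: measurable_cyl.
Qed.

End LocalEvents.

(** * Independence and translation invariance of local events *)

Section ProductMeasure.
Context (R : realType) (d : nat) (p : R) (P : probability (Omega d) R).
Hypothesis bP : bernoulli_product p P.
Implicit Types (s t : seq (vertex d)) (v : vertex d) (E : set (Omega d)).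

Definition letter_pr (b : bool) : R := if b then p else 1 - p.

Lemma pr_cyl s (eta : vertex d -> bool) :
  pr P (cyl s eta) = \prod_(v <- undup s) letter_pr (eta v).
Proof.
have [indep P1 P0] := bP.
have := indep [fset v in s]%fset (fun v => [set eta v]).
rewrite (_ : \bigcap_(_ in _) _ = cyl s eta); last first.
  apply/seteqP; split=> w cw v vs; last by apply: cw; move: vs; rewrite /= inE.
  by apply: cw; rewrite /= inE.
rewrite prE; last exact: measurable_cyl.
rewrite (eq_bigr (fun v => (letter_pr (eta v))%:E)); last first.
  by move=> v _; case: (eta v); [rewrite -(P1 v)|rewrite -(P0 v)].
rewrite prodEFin => -[->]; apply: perm_big.
by apply: uniq_perm; rewrite ?undup_uniq ?fset_uniq// => v; rewrite mem_undup inE.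
Qed.

(** Both sides are additive in each event, so [determined_ind], applied twice, reduces to two
    cylinders over disjoint vertex sets, which merge into one. Measurability is carried along
    because additivity asks for it. *)
Lemma pr_determined_indep s t E E' : (forall v, v \in s -> v \notin t) ->
  determined s E -> determined t E' -> pr P (E `&` E') = pr P E * pr P E'.
Proof.
move=> st sE tE'; have mE' := measurable_determined tE'.
suff [] : measurable E /\ pr P (E `&` E') = pr P E * pr P E' by [].
apply: (@determined_ind _
  (fun A => measurable A /\ pr P (A `&` E') = pr P A * pr P E')) sE.
- by rewrite set0I /pr measure0 /= mul0r.
- move=> A B AB [mA A'] [mB B']; split; first exact: measurableU.
  rewrite setIUl !prU// ?A' ?B' ?mulrDl//; try exact: measurableI.
  by rewrite setIACA AB set0I.
move=> s' eta s's; have mc := measurable_cyl s' eta; split=> //.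
have {st}st v : v \in s' -> v \notin t by rewrite s's; exact: st.
suff [] : measurable E' /\
  pr P (cyl s' eta `&` E') = pr P (cyl s' eta) * pr P E' by [].
apply: (@determined_ind _ (fun A => measurable A /\
  pr P (cyl s' eta `&` A) = pr P (cyl s' eta) * pr P A)) tE'.
- by rewrite setI0 /pr measure0 /= mulr0.
- move=> A B AB [mA A'] [mB B']; split; first exact: measurableU.
  rewrite setIUr !prU// ?A' ?B' ?mulrDr//; try exact: measurableI.
  by rewrite setIACA AB setI0.
move=> t' eta' t't; split; first exact: measurable_cyl.
pose eta2 v := if v \in s' then eta v else eta' v.
have nt v : v \in t' -> (v \in s') = false.
  by rewrite t't => vt; apply/negbTE/negP => /st; rewrite vt.
rewrite (_ : _ `&` _ = cyl (s' ++ t') eta2); last first.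
  apply/seteqP; split=> [w [cs ct] v|w c].
    rewrite mem_cat /eta2; case: ifP => [vs _|_ /= vt]; [exact: cs|exact: ct].
  split=> v vs; first by rewrite c ?mem_cat ?vs// /eta2 vs.
  by rewrite c ?mem_cat ?vs ?orbT// /eta2 nt.
rewrite !pr_cyl.
rewrite (perm_big (undup s' ++ undup t')) /=; last first.
  apply: uniq_perm; rewrite ?undup_uniq// ?cat_uniq ?undup_uniq ?andbT/=.
    by apply/hasPn => v; rewrite /= !mem_undup => /nt->.
  by move=> v; rewrite mem_undup !mem_cat !mem_undup.
rewrite big_cat; congr (_ * _); rewrite !big_seq; apply: eq_bigr => v;
  rewrite mem_undup /eta2; [by move=> ->|by move/nt=> ->].
Qed.

Lemma pr_determined_shift s E v0 : determined s E ->
  let sh := fun w : Omega d => (fun v => w (v + v0)) : Omega d in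
  measurable (sh @^-1` E) /\ pr P (sh @^-1` E) = pr P E.
Proof.
move=> sE sh.
suff [] : measurable E /\
  (measurable (sh @^-1` E) /\ pr P (sh @^-1` E) = pr P E) by [].
apply: (@determined_ind _ (fun E => measurable E /\
  (measurable (sh @^-1` E) /\ pr P (sh @^-1` E) = pr P E))) sE.
- by rewrite preimage_set0.
- move=> A B AB [mA [mA' A']] [mB [mB' B']]; split; first exact: measurableU.
  rewrite preimage_setU; split; first exact: measurableU.
  by rewrite !prU// ?A' ?B'// -preimage_setI AB preimage_set0.
move=> t eta _.
have -> : sh @^-1` cyl t eta = cyl [seq v + v0 | v <- t] (fun v => eta (v - v0)).
  apply/seteqP; split=> w cw v.
    by move=> /mapP[u ut ->]; rewrite addrK -cw.
  by move=> vt; rewrite -[LHS]/(X (v + v0) w) (cw _ (map_f _ vt)) addrK.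
split; first exact: measurable_cyl.
split; first exact: measurable_cyl.
rewrite !pr_cyl undup_map_inj; last exact: addIr.
by rewrite big_map; apply: eq_bigr => v _; rewrite addrK.
Qed.

(** The induction splits off one event from the intersection of the others, and so must also record
    where that intersection is determined. *)
Lemma pr_determined_indep_seq (I : eqType) (r : seq I) (s : I -> seq (vertex d))
    (F : I -> set (Omega d)) :
  uniq r ->
  (forall i j, i != j -> forall v, v \in s i -> v \notin s j) ->
  (forall i, determined (s i) (F i)) ->
  determined (flatten [seq s i | i <- r]) [set w | forall i, i \in r -> F i w] /\
  pr P [set w | forall i, i \in r -> F i w] = \prod_(i <- r) pr P (F i).
Proof.
move=> + sd sF; elim: r => [_|i r IH /= /andP[ir ur]].
  rewrite (_ : [set _ | _] = setT) ?big_nil ?pr_setT//; exact/seteqP.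
have [dr prI] := IH ur.
rewrite (_ : [set _ | _] = F i `&` [set w | forall i, i \in r -> F i w]); last first.
  apply/seteqP; split=> [w Fw|w [Fi Fr] j]; last first.
    by rewrite inE => /predU1P[->//|]; exact: Fr.
  by split=> [|j jr]; apply: Fw; rewrite inE ?eqxx ?jr ?orbT.
split; first exact: determinedI.
rewrite big_cons (pr_determined_indep _ (sF i) dr) ?prI// => v vi.
apply/negP => /flattenP[_ /mapP[j jr ->]]; apply/negP.
by apply: sd vi; apply: contraNneq ir => ->.
Qed.

End ProductMeasure.

(** * Words seen up to a finite length *)

Lemma konig (T : eqType) (ok : seq T -> Prop) :
  (forall s t, ok (s ++ t) -> ok s) ->
  (forall s, exists l : seq T, forall x, ok (rcons s x) -> x \in l) ->
  (forall n, exists2 s, size s = n & ok s) ->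
  exists f : nat -> T, forall n, ok (mkseq f n).
Proof.
move=> pre br long.
(* Extendable prefixes: those with admissible continuations of every length. Some one-letter
   extension is again extendable, and iterated choice yields [f]. *)
pose ext s := forall n, exists2 t, size t = n & ok (s ++ t).
have extS s : ext s -> exists x, ext (rcons s x).
  move=> es; apply: contrapT => nx.
  have /choice[N NP] : forall x, exists n, forall t, size t = n -> ~ ok (rcons s x ++ t).
    move=> x; apply: contrapT => nN; apply: nx; exists x => n.
    apply: contrapT => nt; apply: nN; exists n => t tn okt.
    by apply: nt; exists t.
  have [l lP] := br s.
  (* If each letter [y] had a forbidden continuation length [N y], a continuation longer than all of
     these would, after its first letter [x], contain one of length [N x]. *)
  have [[//|x t] [tM] okt] := es (\max_(y <- l) N y).+1.
  rewrite -cat_rcons in okt.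
  have xl : x \in l by apply: lP; exact: pre okt.
  have Nx : (N x <= size t)%N by rewrite tM; exact: leq_bigmax_seq.
  apply: (NP x (take (N x) t)); first exact: size_takel.
  by apply: (pre _ (drop (N x) t)); rewrite -catA cat_take_drop.
have ext0 : ext [::] by move=> n; have [s] := long n; exists s.
pose next (s : {s | ext s}) : T := sval (cid (extS _ (svalP s))).
pose Next (s : {s | ext s}) : {s | ext s} :=
  exist _ (rcons (sval s) (next s)) (svalP (cid (extS _ (svalP s)))).
pose F n := iter n Next (exist _ [::] ext0).
exists (fun n => next (F n)) => n.
suff -> : mkseq (fun n => next (F n)) n = sval (F n).
  by have [t _] := svalP (F n) 0%N; exact: pre.
by elim: n => [//|n IH]; rewrite mkseqS IH.
Qed.

Section FiniteWords.
Context (d : nat).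
Implicit Types (v u : vertex d) (w : Omega d) (xi : word).

(** The sup-norm ball, listed by functions with values from 0 to 2N that are recentred by
    subtracting N. *)
Definition ball_seq v (N : nat) : seq (vertex d) :=
  [seq [ffun i => v i + (f i : nat)%:Z - N%:Z] | f : {ffun 'I_d -> 'I_(N + N).+1}].

Lemma mem_ball_seq v N u : (forall i, `|u i - v i| <= N%:Z) <-> u \in ball_seq v N.
Proof.
rewrite /ball_seq; split=> [uv|/mapP[f _ ->] i]; last first.
  by rewrite ffunE; move: (v i) (nat_of_ord _) (ltn_ord (f i)) => a m; lia.
apply/mapP; exists [ffun i => inord (absz (u i - v i + N%:Z))].
  by rewrite mem_enum.
apply/ffunP => i; rewrite !ffunE; move: (uv i); move: (u i) (v i) => a b ab.
by rewrite inordK; lia.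
Qed.

Definition path_upto (K : int) v (gamma : nat -> vertex d) (n : nat) : Prop :=
  [/\ gamma 0%N = v,
      forall j k, (j <= n)%N -> (k <= n)%N -> gamma j = gamma k -> j = k &
      forall k, (k < n)%N -> adj K (gamma k) (gamma k.+1)].

Definition seen_upto (K : int) v w xi (n : nat) : Prop :=
  exists2 gamma : nat -> vertex d, path_upto K v gamma n &
    forall k, (k < n)%N -> X (gamma k.+1) w = xi k.

Definition all_seen_upto (K : int) v (n : nat) : set (Omega d) :=
  [set w | forall xi, seen_upto K v w xi n].

Lemma adj_dist (K : nat) v u : adj K v u -> forall i, `|v i - u i| <= K%:Z.
Proof.
move=> [i [/andP[_ K1 ne]] j]; have [->//|/ne->] := eqVneq j i.
by rewrite subrr normr0.
Qed.

Lemma path_upto_dist (K : nat) v gamma n : path_upto K v gamma n ->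
  forall k, (k <= n)%N -> gamma k \in ball_seq v (n * K).
Proof.
move=> [g0 _ gadj] k kn; apply/mem_ball_seq => i.
suff : `|gamma k i - v i| <= (k * K)%:Z.
  by move/le_trans; apply; rewrite lez_nat leq_mul2r kn orbT.
elim: k kn => [|k IH] kn; first by rewrite g0 subrr.
have := IH (ltnW kn); have := adj_dist (gadj k kn) i.
by move: (gamma k i) (gamma k.+1 i) (v i) => a b c; rewrite mulSn; lia.
Qed.

Lemma determined_all_seen_upto (K : nat) v n :
  determined (ball_seq v (n * K)) (all_seen_upto K v n).
Proof.
move=> w w' ww' sw xi; have [gamma pg Xg] := sw xi; exists gamma => // k kn.
by rewrite -ww' ?Xg//; exact: path_upto_dist pg _ _.
Qed.

Lemma measurable_all_seen_upto (K : nat) v n : measurable (all_seen_upto K v n).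
Proof. exact: (measurable_determined (@determined_all_seen_upto K v n)). Qed.

Lemma all_seen_upto_sub (K : int) v m n : (m <= n)%N ->
  all_seen_upto K v n `<=` all_seen_upto K v m.
Proof.
move=> mn w sw xi; have [gamma [g0 ginj gadj] Xg] := sw xi.
exists gamma => [|k km]; last exact: Xg (leq_trans km mn).
split=> // [j k jm km|k km]; last exact: gadj (leq_trans km mn).
by apply: ginj; exact: leq_trans mn.
Qed.

Lemma seenP (K : nat) v w xi : (forall n, seen_upto K v w xi n) -> seen K v w xi.
Proof.
move=> sn.
(* Here [s] lists the vertices after [v], so entry [k] of [v :: s] precedes entry [k] of [s].
   Branching is finite because the next vertex lies within distance [K] of the last one. *)
pose ok s := uniq (v :: s) /\ forall k, (k < size s)%N ->
  adj K (nth v (v :: s) k) (nth v s k) /\ X (nth v s k) w = xi k.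
have [||n|f fok] := @konig _ ok.
- move=> s t [ust okst]; split.
    by move: ust; rewrite -cat_cons cat_uniq => /andP[].
  move=> k ks; have := okst k; rewrite size_cat nth_cat ks.
  rewrite -cat_cons nth_cat /= ltnS (ltnW ks); apply.
  exact: ltn_addr.
- move=> s; exists (ball_seq (last v s) K) => x [_ /(_ (size s))].
  rewrite size_rcons ltnS leqnn -rcons_cons !nth_rcons ltnn eqxx ltnS leqnn -last_nth.
  move=> /(_ isT)[/adj_dist ax _].
  by apply/mem_ball_seq => i; rewrite distrC.
- have [gamma [g0 ginj gadj] Xg] := sn n.
  exists (mkseq (fun k => gamma k.+1) n); first by rewrite size_mkseq.
  have mk : v :: mkseq (fun k => gamma k.+1) n = mkseq gamma n.+1.
    by rewrite /mkseq /= g0 -[in RHS](addn0 1%N) iotaDl -map_comp.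
  split.
    rewrite mk; apply/(uniqP v) => i j; rewrite !inE size_mkseq => i1 j1.
    by rewrite !nth_mkseq//; exact: ginj.
  move=> k; rewrite size_mkseq => kn.
  by rewrite mk !nth_mkseq// ?(leqW kn)//; split; [exact: gadj|exact: Xg].
(* Index [k] is the last entry of this list: [g] starts at [v] and continues with [f]. By [gE],
   longer prefixes give the same value. *)
pose g k := nth v (v :: mkseq f k) k.
have gE n k : (k <= n)%N -> g k = nth v (v :: mkseq f n) k.
  rewrite /g; case: k => [//|k] kn /=; rewrite !nth_mkseq//; lia.
exists g.
  split=> [//|j k|n].
    have [u _] := fok (maxn j k).
    rewrite (gE (maxn j k)) ?leq_maxl// (gE (maxn j k) k) ?leq_maxr//.
    by apply: (uniqP v u); rewrite inE /= size_mkseq ltnS ?leq_maxl ?leq_maxr.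
  have [_ /(_ n)] := fok n.+1; rewrite size_mkseq ltnS leqnn => /(_ isT)[+ _].
  by rewrite (gE n.+1 n)// (gE n.+1 n.+1).
move=> n; have [_ /(_ n)] := fok n.+1; rewrite size_mkseq ltnS leqnn => /(_ isT)[_].
by rewrite (gE n.+1 n.+1).
Qed.

(** Koenig's lemma acts on one configuration and one word at a time. Only finitely many letters
    matter at each length, so the uncountable quantifier over words becomes a countable intersection
    of local events, which is measurable. *)
Lemma all_words_seenE (K : nat) v :
  all_words_seen K v = \bigcap_n all_seen_upto K v n.
Proof.
apply/seteqP; split=> w sw.
  move=> n _ xi; have : seen_words K v w xi by rewrite sw.
  move=> [gamma [g0 ginj gadj] Xg]; exists gamma => //; split=> // j k _ _.
  exact: ginj.
by apply/seteqP; split=> // xi _; apply: seenP => n; exact: sw.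
Qed.

Lemma measurable_all_words_seen (K : nat) v : measurable (all_words_seen K v).
Proof.
by rewrite all_words_seenE; apply: bigcap_measurable => // n _;
  exact: measurable_all_seen_upto.
Qed.

Lemma all_seen_upto_shift (K : int) v n :
  all_seen_upto K v n =
  (fun w : Omega d => (fun u => w (u + v)) : Omega d) @^-1` all_seen_upto K (origin d) n.
Proof.
have o0 : origin d = 0 by apply/ffunP => i; rewrite !ffunE.
have adjB (x y z : vertex d) : adj K x y -> adj K (x + z) (y + z).
  move=> [i [xy ne]]; exists i; rewrite !ffunE.
  split; first by rewrite opprD addrACA subrr addr0.
  by move=> j /ne xyj; rewrite !ffunE xyj.
apply/seteqP; split=> w sw xi; have [gamma [g0 ginj gadj] Xg] := sw xi.
  exists (fun k => gamma k - v); last first.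
    by move=> k /Xg <-; rewrite /X subrK.
  split=> [|j k jn kn /addIr|k kn]; first by rewrite g0 subrr o0.
    exact: ginj.
  by apply: adjB; exact: gadj.
exists (fun k => gamma k + v); last by move=> k /Xg <-.
split=> [|j k jn kn /addIr|k kn]; first by rewrite g0 o0 add0r.
  exact: ginj.
by apply: adjB; exact: gadj.
Qed.

End FiniteWords.

(** * Positive probability at one vertex versus probability one somewhere *)

Section ZeroOneLaw.
Context (R : realType) (d : nat) (p : R) (P : probability (Omega d) R).
Hypotheses (d_gt0 : (0 < d)%N) (bP : bernoulli_product p P).
Context (K : nat).
Implicit Types v : vertex d.

Lemma pr_all_seen_upto v n :
  pr P (all_seen_upto K v n) = pr P (all_seen_upto K (origin d) n).
Proof.
rewrite all_seen_upto_shift.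
by have [] := pr_determined_shift bP v (@determined_all_seen_upto d K (origin d) n).
Qed.

Lemma cvg_all_seen_upto v :
  pr P (all_seen_upto K v n) @[n --> \oo] --> pr P (all_words_seen K v).
Proof.
rewrite all_words_seenE; apply: pr_bigcap_cvg.
  by move=> n; exact: measurable_all_seen_upto.
by move=> n; exact: all_seen_upto_sub.
Qed.

(** Translation invariance, available for local events, passes to the limit in the length. *)
Lemma pr_all_words_seen v :
  pr P (all_words_seen K v) = pr P (all_words_seen K (origin d)).
Proof.
have cv := @cvg_all_seen_upto v.
have c0 : pr P (all_seen_upto K v n) @[n --> \oo] -->
    pr P (all_words_seen K (origin d)).
  by under eq_fun do rewrite pr_all_seen_upto; exact: cvg_all_seen_upto.
by rewrite -(cvg_lim (@norm_hausdorff _ _) cv) (cvg_lim (@norm_hausdorff _ _) c0).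
Qed.

Lemma pr_all_words_seen_le v n :
  pr P (all_words_seen K v) <= pr P (all_seen_upto K v n).
Proof.
apply: le_pr; first exact: measurable_all_words_seen.
  exact: measurable_all_seen_upto.
by rewrite all_words_seenE => w; exact.
Qed.

Lemma measurable_bigcup_all_words_seen :
  measurable (\bigcup_(v in [set: vertex d]) all_words_seen K v).
Proof.
apply: countable_bigcupT_measurable; first exact: countableP.
by move=> v; exact: measurable_all_words_seen.
Qed.

Lemma pr_bigcup_all_words_seenC_le m n :
  pr P (~` \bigcup_(v in [set: vertex d]) all_words_seen K v) <=
  (1 - pr P (all_words_seen K (origin d))) ^+ m +
  m%:R * (pr P (all_seen_upto K (origin d) n) - pr P (all_words_seen K (origin d))).
Proof.
(* The spacing 2nK + 1 makes the balls of radius nK disjoint, as any single coordinate shows. *)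
pose far (k : nat) : vertex d := [ffun=> (k * (n * K + n * K).+1)%:Z].
have far_disj j k : j != k ->
    forall v, v \in ball_seq (far j) (n * K) -> v \notin ball_seq (far k) (n * K).
  move=> jk v /mem_ball_seq/(_ (Ordinal d_gt0)) vj; apply/negP.
  move=> /mem_ball_seq/(_ (Ordinal d_gt0)); move: vj; rewrite !ffunE.
  move: (v _) (n * K)%N => a b aj ak.
  wlog jk' : j k jk aj ak / (j < k)%N.
    by move=> H; have [] := ltngtP j k; [exact: H|by apply: H; rewrite // eq_sym|exact/eqP].
  have : (j.+1 * (b + b).+1 <= k * (b + b).+1)%N by rewrite leq_mul2r jk' orbT.
  move: aj ak; rewrite mulSn; move: (j * _)%N (k * _)%N => x y; lia.
have mA v := measurable_all_words_seen K v.
have mAn v := @measurable_all_seen_upto d K v n.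
have [dI prI] := pr_determined_indep_seq bP (iota_uniq 0 m) far_disj
  (fun k => determinedC (@determined_all_seen_upto d K (far k) n)).
set I := [set w | _] in dI prI.
(* If no vertex sees all words, either every far vertex fails already by length [n], which is [I],
   or some far vertex fails only later, which is [D]. *)
pose D := [set w | exists2 k, k \in iota 0 m &
  (all_seen_upto K (far k) n `\` all_words_seen K (far k)) w].
have mD : measurable D.
  by apply: measurable_exists_seq => k; exact: measurableD.
have mI := measurable_determined dI.
apply: (@le_trans _ _ (pr P (I `|` D))).
  apply: le_pr; [exact: measurableC measurable_bigcup_all_words_seen|exact: measurableU|].
  move=> w nU; have [Iw|/existsNP[k /not_implyP[km kw]]] := pselect (I w); first by left.
  right; exists k => //; split; first exact: contrapT.
  by move=> kA; apply: nU; exists (far k).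
apply: le_trans (le_prU _ mI mD) _; apply: lerD.
  rewrite prI (eq_bigr (fun=> 1 - pr P (all_seen_upto K (origin d) n))); last first.
    by move=> k _; rewrite prC// pr_all_seen_upto.
  rewrite big_const_seq count_predT size_iota iter_mulr_1.
  by rewrite lerXn2r ?nnegrE ?subr_ge0 ?pr_le1// lerB// pr_all_words_seen_le.
apply: le_trans (le_pr_exists_seq (f := fun=> pr P (all_seen_upto K (origin d) n) -
    pr P (all_words_seen K (origin d))) _ _) _ => /=.
- by move=> k; exact: measurableD.
- move=> k _; rewrite prD// ?pr_all_seen_upto ?pr_all_words_seen//.
  by rewrite all_words_seenE => w; exact.
by rewrite big_const_seq count_predT size_iota iter_addr_0 mulr_natl.
Qed.

Lemma all_words_seen_bigcup_iff :
  0 < pr P (all_words_seen K (origin d)) <->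
  pr P (\bigcup_(v in [set: vertex d]) all_words_seen K v) = 1.
Proof.
have mU := measurable_bigcup_all_words_seen.
have mA v := measurable_all_words_seen K v.
set c := pr P (all_words_seen K (origin d)); split=> [c_gt0|U1].
  apply/eqP; rewrite eq_le pr_le1//= -subr_le0 -prC//.
  (* For fixed [m], letting [n] grow removes the linear error term. *)
  have le_exp m : pr P (~` \bigcup_(v in [set: vertex d]) all_words_seen K v) <=
      (1 - c) ^+ m.
    have := @pr_bigcup_all_words_seenC_le m; rewrite -/c => le_n.
    have cv : (1 - c) ^+ m + m%:R * (pr P (all_seen_upto K (origin d) n) - c)
        @[n --> \oo] --> (1 - c) ^+ m + m%:R * (c - c).
      apply: cvgD; first exact: cvg_cst.
      apply: cvgM; first exact: cvg_cst.
      by apply: cvgB; [exact: cvg_all_seen_upto|exact: cvg_cst].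
    rewrite subrr mulr0 addr0 in cv.
    by apply: (cvgr_to_ge cv); exact: nearW.
  have : (1 - c) ^+ m @[m --> \oo] --> (0 : R).
    apply: cvg_expr; rewrite ger0_norm ?subr_ge0 ?pr_le1//.
    by rewrite ltrBlDr ltrDl.
  move/cvgr_to_ge; apply.
  exact: nearW.
rewrite lt0r pr_ge0 andbT; apply/eqP => c0.
have := @oner_neq0 R; rewrite -U1 => /eqP; apply.
suff : P.-negligible (\bigcup_(v in [set: vertex d]) all_words_seen K v).
  by move=> /negligibleP-/(_ mU); rewrite /pr => ->.
have PA0 v : P (all_words_seen K v) = 0%E by rewrite prE// pr_all_words_seen -/c c0.
(* The union over vertices is rewritten along their codes; a code of no vertex contributes the empty
   set. *)
pose F (k : nat) : set (Omega d) :=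
  if (choice.unpickle k : option (vertex d)) is Some v then all_words_seen K v else set0.
apply: (@negligibleS _ _ _ _ (\bigcup_k F k)).
  by move=> w [v _ vw]; exists (choice.pickle v) => //; rewrite /F choice.pickleK.
apply: negligible_bigcup => k; rewrite /F; case: choice.unpickle => [v|].
  by apply/negligibleP => //; exact: PA0.
exact: negligible_set0.
Qed.

End ZeroOneLaw.

(** * Good boxes *)

Section Boxes.
Context (d : nat) (i0 i1 : 'I_d) (L : nat).
Hypotheses (i01 : i0 != i1) (L_gt0 : (0 < L)%N).
Implicit Types (a b B : site) (w : Omega d) (s t : seq site).

Definition plane a : vertex d :=
  [ffun i => if i == i0 then a.1%:Z else if i == i1 then a.2%:Z else 0].

Lemma plane_inj : injective plane.
Proof.
move=> [x y] [x' y'] /ffunP e.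
have := e i0; rewrite !ffunE eqxx /= => -[<-].
by have := e i1; rewrite !ffunE eqxx eq_sym (negbTE i01) /= => -[<-].
Qed.

Lemma plane0 : plane (0%N, 0%N) = origin d.
Proof. by apply/ffunP => i; rewrite !ffunE; case: (i == i0) => //; case: (i == i1). Qed.

Definition box_of a : site := (a.1 %/ L, a.2 %/ L)%N.

Definition box_column B (x : nat) : seq site :=
  [seq (B.1 * L + x, B.2 * L + y)%N | y <- iota 0 L].

Definition box_row B (y : nat) : seq site :=
  [seq (B.1 * L + x, B.2 * L + y)%N | x <- iota 0 L].

Definition lines B : seq (seq site) :=
  [seq box_column B x | x <- iota 0 L] ++ [seq box_row B y | y <- iota 0 L].

Definition both_letters w (l : seq site) : bool :=
  has (fun a => X (plane a) w) l && has (fun a => ~~ X (plane a) w) l.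

Definition good_box w : pred site := fun B => all (both_letters w) (lines B).

Lemma box_of_offset B (x y : nat) : (x < L)%N -> (y < L)%N ->
  box_of (B.1 * L + x, B.2 * L + y)%N = B.
Proof.
move=> xL yL; rewrite /box_of /= !divnMDl// !divn_small// !addn0.
by rewrite -surjective_pairing.
Qed.

Lemma lines_box B l a : l \in lines B -> a \in l -> box_of a = B.
Proof.
rewrite mem_cat => /orP[] /mapP[x]; rewrite mem_iota => /andP[_ xL] ->;
  by move=> /mapP[y]; rewrite mem_iota => /andP[_ yL] ->; rewrite box_of_offset.
Qed.

Lemma both_lettersP w l (c : bool) : both_letters w l ->
  exists2 a, a \in l & X (plane a) w = c.
Proof.
move=> /andP[/hasP[a al wa] /hasP[b bl wb]].
by case: c; [exists a|exists b => //; exact/negbTE].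
Qed.

(** The row or column through [a] continues into the neighbouring box, where a full segment of it
    contains both letters; the distance covered is less than 2L. *)
Lemma good_box_step w a B c : good_box w B -> nbr (box_of a) B ->
  exists b, [/\ box_of b = B, adj (L + L)%N%:Z (plane a) (plane b) &
                X (plane b) w = c].
Proof.
case: a => x y /allP gB /orP[] /andP[/eqP /= e1 e2].
- have lB : box_column B (x %% L) \in lines B.
    by rewrite mem_cat map_f// mem_iota add0n ltn_pmod.
  have [b bl wb] := both_lettersP c (gB _ lB).
  exists b; split=> //; first exact: lines_box bl.
  move: bl => /mapP[y' ]; rewrite mem_iota => /andP[_ y'L] ->.
  exists i1; rewrite !ffunE eqxx eq_sym (negbTE i01) /= -e1 -divn_eq; split.
    have := divn_eq y L; have := ltn_pmod y L_gt0.
    move: e2; move: (y %/ L)%N (y %% L)%N B.2 => q r q' /orP[] /eqP; nia.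
  by move=> j j1; rewrite !ffunE (negbTE j1).
- have lB : box_row B (y %% L) \in lines B.
    by rewrite mem_cat map_f ?orbT// mem_iota add0n ltn_pmod.
  have [b bl wb] := both_lettersP c (gB _ lB).
  exists b; split=> //; first exact: lines_box bl.
  move: bl => /mapP[x' ]; rewrite mem_iota => /andP[_ x'L] ->.
  exists i0; rewrite !ffunE eqxx /= -e1 -divn_eq; split.
    have := divn_eq x L; have := ltn_pmod x L_gt0.
    move: e2; move: (x %/ L)%N (x %% L)%N B.1 => q r q' /orP[] /eqP; nia.
  by move=> j j0; rewrite !ffunE (negbTE j0).
Qed.

(** The word is generalised because each step consumes its first letter. *)
Lemma good_box_path w a s (xi : word) : path (step (good_box w)) (box_of a) s ->
  exists t, map box_of t = s /\ forall k, (k < size s)%N ->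
    adj (L + L)%N%:Z (plane (nth a (a :: t) k)) (plane (nth a t k)) /\
    X (plane (nth a t k)) w = xi k.
Proof.
elim: s a xi => [|B s IH] a xi /=; first by exists [::].
move=> /andP[/andP[aB gB] pB].
have [b [bB ab wb]] := good_box_step (xi 0%N) gB aB.
rewrite -bB in pB; have [t [ts tP]] := IH b (fun k => xi k.+1) pB.
exists (b :: t); split; first by rewrite /= bB ts.
have st : size t = size s by rewrite -ts size_map.
case=> [//|k]; rewrite ltnS => ks; have := tP k ks.
rewrite [nth a (a :: _) _]/= [nth a (b :: t) k.+1]/=.
by rewrite !(set_nth_default b a) ?st//= st ltnS ltnW.
Qed.

(** The vertices of the path are distinct because they lie in distinct boxes. *)
Lemma good_box_seen w n : (forall k, (k <= n.+1)%N -> good (good_box w) k (0%N, 0%N)) ->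
  all_seen_upto (L + L)%N (origin d) n w.
Proof.
move=> /good_long_path[s [ps us ns]] xi.
have b0 : box_of (0%N, 0%N) = (0%N, 0%N) by rewrite /box_of /= div0n.
rewrite -b0 in ps; have [t [ts tP]] := good_box_path xi ps.
have st : size t = size s by rewrite -ts size_map.
have ut : uniq ((0%N, 0%N) :: t).
  by apply: (@map_uniq _ _ box_of); rewrite /= b0 ts.
exists (fun k => plane (nth (0%N, 0%N) ((0%N, 0%N) :: t) k)).
  split=> [|j k jn kn /plane_inj|k kn]; first exact: plane0.
    by apply: (uniqP _ ut); rewrite inE /= st ltnS (leq_trans _ ns).
  by have [] := tP k (leq_trans kn ns).
by move=> k kn; have [] := tP k (leq_trans kn ns).
Qed.

Definition block (n : nat) B : seq (vertex d) :=
  [seq plane (x, y) | x <- iota (B.1 * (L * 3 ^ n)) (L * 3 ^ n),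
                      y <- iota (B.2 * (L * 3 ^ n)) (L * 3 ^ n)].

Lemma mem_block n B v : reflect
  (exists a, [/\ v = plane a, a.1 %/ (L * 3 ^ n) = B.1 & a.2 %/ (L * 3 ^ n) = B.2]%N)
  (v \in block n B).
Proof.
have S_gt0 : (0 < L * 3 ^ n)%N by rewrite muln_gt0 L_gt0 expn_gt0.
have memE x q : (x \in iota (q * (L * 3 ^ n)) (L * 3 ^ n)) = (x %/ (L * 3 ^ n) == q)%N.
  by rewrite mem_iota -mulSnr -leq_divRL// -ltn_divLR// ltnS andbC -eqn_leq.
apply: (iffP allpairsP) => [[[x y] [/= + + ->]]|[[x y] [-> /= x1 y1]]].
  by rewrite !memE => /eqP xB /eqP yB; exists (x, y).
by exists (x, y); rewrite !memE x1 y1 !eqxx.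
Qed.

Lemma block_disjoint n B B' v : B != B' -> v \in block n B -> v \notin block n B'.
Proof.
move=> BB' /mem_block[a [va a1 a2]]; apply/negP => /mem_block[b [vb b1 b2]].
have ab : a = b by apply: plane_inj; rewrite -va -vb.
move: BB'; rewrite (surjective_pairing B) (surjective_pairing B').
by rewrite -a1 -a2 -b1 -b2 ab eqxx.
Qed.

Definition bad (n : nat) B : set (Omega d) := [set w | ~~ good (good_box w) n B].

Lemma determined_bad n B : determined (block n B) (bad n B).
Proof.
move=> w w' ww'; rewrite /bad /=; apply: contraNN.
rewrite (@good_ext _ (good_box w')) // => x x1 x2.
apply: eq_in_all => l lB; rewrite /both_letters.
have Xl : {in l, forall a, X (plane a) w = X (plane a) w'}.
  move=> a al; apply: ww'; apply/mem_block; exists a.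
  by move: x1 x2; rewrite -(lines_box lB al) /= !divnMA.
congr (_ && _); apply: eq_in_has => a al; by rewrite Xl.
Qed.

Lemma measurable_bad n B : measurable (bad n B).
Proof. exact: (measurable_determined (@determined_bad n B)). Qed.

(** * Probability that a box is bad, level by level *)

Section BadProbability.
Context (R : realType) (p : R) (P : probability (Omega d) R).
Hypotheses (p01 : 0 < p < 1) (bP : bernoulli_product p P).

(** Union bound over 2L lines and two letters: a bad box has a line on which one letter is
    constant. *)
Lemma pr_bad0 B : pr P (bad 0 B) <= (4 * L)%:R * Num.max p (1 - p) ^+ L.
Proof.
have /andP[p0 p1] := p01.
pose lbs := [seq (l, c) | l <- lines B, c <- [:: true; false]].
pose F (lb : seq site * bool) := cyl [seq plane a | a <- lb.1] (fun=> lb.2).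
have lineP l : l \in lines B -> uniq l /\ size l = L.
  rewrite mem_cat => /orP[] /mapP[x _ ->]; rewrite size_map size_iota;
    by rewrite map_inj_uniq ?iota_uniq// => y z [] /addnI.
have badE : bad 0 B `<=` [set w | exists2 lb, lb \in lbs & F lb w].
  move=> w /= /allPn[l lB]; rewrite negb_and => /orP[] /hasPn nl.
    exists (l, false); first by apply/allpairsP; exists (l, false).
    by move=> v /mapP[a al ->]; apply/negbTE; exact: nl.
  exists (l, true); first by apply/allpairsP; exists (l, true).
  by move=> v /mapP[a al ->]; apply/negPn; exact: nl.
have mF lb : measurable (F lb) by exact: measurable_cyl.
have Fle lb : lb \in lbs -> pr P (F lb) <= Num.max p (1 - p) ^+ L.
  move=> /allpairsP[[l c] [/= lB _ ->]]; have [ul sl] := lineP l lB.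
  rewrite (pr_cyl bP) /= undup_id ?map_inj_uniq//; last exact: plane_inj.
  rewrite big_map big_const_seq count_predT sl iter_mulr_1 lerXn2r// ?nnegrE.
  - by case: c; rewrite /letter_pr; lra.
  - by rewrite le_max; apply/orP; left; lra.
  by case: c; rewrite /letter_pr le_max lexx ?orbT.
apply: (@le_trans _ _ (pr P [set w | exists2 lb, lb \in lbs & F lb w])).
  apply: le_pr => //; first exact: measurable_bad.
  exact: measurable_exists_seq.
apply: le_trans (le_pr_exists_seq mF Fle) _.
rewrite big_const_seq count_predT iter_addr_0 size_allpairs /=.
rewrite size_cat !size_map size_iota mulr_natl.
by rewrite addnn -muln2 -mulnA mulnC.
Qed.

(** The 81 counts ordered pairs of the nine children; two distinct bad children are independent
    since their blocks are disjoint. *)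
Lemma pr_badS (e : R) n : (forall B, pr P (bad n B) <= e) ->
  forall B, pr P (bad n.+1 B) <= 81 * e ^+ 2.
Proof.
move=> le_e B.
pose cs := [seq (c, c') | c <- children B, c' <- children B].
pose F (cc : site * site) := if cc.1 == cc.2 then set0 else bad n cc.1 `&` bad n cc.2.
have mF cc : measurable (F cc).
  rewrite /F; case: ifP => // _; apply: measurableI; exact: measurable_bad.
have e_ge0 : 0 <= e by apply: le_trans (le_e B); exact: pr_ge0.
have Fle cc : cc \in cs -> pr P (F cc) <= e ^+ 2.
  move=> _; rewrite /F; case: eqVneq => [_|ne].
    by rewrite /pr measure0 exprn_ge0.
  rewrite (pr_determined_indep bP _ (@determined_bad n cc.1) (@determined_bad n cc.2)).
    by rewrite expr2 ler_pM ?pr_ge0.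
  by move=> v; exact: block_disjoint.
apply: (@le_trans _ _ (pr P [set w | exists2 cc, cc \in cs & F cc w])).
  apply: le_pr; first exact: measurable_bad.
    exact: measurable_exists_seq.
  move=> w /allPn[c cB /allPn[c' cB']]; rewrite !negb_or => /and3P[ne gc gc'].
  exists (c, c'); first by apply/allpairsP; exists (c, c').
  by rewrite /F /= (negbTE ne).
apply: le_trans (le_pr_exists_seq mF Fle) _.
by rewrite big_const_seq count_predT iter_addr_0 size_allpairs mulr_natl.
Qed.

(** Chosen so that [81 * e ^ 2] is at most [e / 4] for [e] the bound at any level, which makes the
    bounds reproduce themselves and sum geometrically. *)
Definition level_bound (n : nat) : R := 81^-1 * 4^-1 ^+ n.+1.

Lemma level_boundS n : level_bound n.+1 = level_bound n / 4.
Proof. by rewrite /level_bound (exprSr _ n.+1) mulrA. Qed.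

Lemma level_bound_ge0 n : 0 <= level_bound n.
Proof. by rewrite /level_bound mulr_ge0 ?exprn_ge0. Qed.

Lemma level_bound_le0 n : level_bound n <= level_bound 0.
Proof.
elim: n => [//|n]; apply: le_trans; rewrite level_boundS.
by have := level_bound_ge0 n; lra.
Qed.

Lemma sum_level_bound m : \sum_(k <- iota 0 m) level_bound k <= 2^-1.
Proof.
(* The remainder closes the induction: twice a bound exceeds the bound plus twice the next one. *)
suff : \sum_(k <- iota 0 m) level_bound k <= 2^-1 - 2 * level_bound m.
  by have := level_bound_ge0 m; lra.
elim: m => [|m IH].
  by rewrite big_nil /level_bound expr1; lra.
rewrite -addn1 iotaD big_cat big_seq1 /= add0n addn1 level_boundS.
by have := level_bound_ge0 m; lra.
Qed.

Hypothesis L_large : (4 * L)%:R * Num.max p (1 - p) ^+ L <= level_bound 0.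

Lemma pr_bad_le n B : pr P (bad n B) <= level_bound n.
Proof.
elim: n B => [|n IH] B; first exact: le_trans (pr_bad0 B) L_large.
apply: le_trans (pr_badS IH B) _; rewrite level_boundS expr2.
have e0 := level_bound_ge0 n; have := level_bound_le0 n.
rewrite {2}/level_bound expr1 => e1.
have : level_bound n * level_bound n <= level_bound n * (81^-1 * 4^-1).
  by rewrite ler_wpM2l.
lra.
Qed.

(** A union bound over the levels of the boxes at the origin; being uniform in [n], the estimate
    survives the limit. *)
Lemma pr_all_seen_upto_ge n : 2^-1 <= pr P (all_seen_upto (L + L)%N (origin d) n).
Proof.
pose U := [set w | exists2 k, k \in iota 0 n.+2 & bad k (0%N, 0%N) w].
have mU : measurable U.
  by apply: measurable_exists_seq => k; exact: measurable_bad.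
have Ule : pr P U <= 2^-1.
  apply: le_trans (sum_level_bound n.+2).
  apply: le_pr_exists_seq => k; first exact: measurable_bad.
  by move=> _; exact: pr_bad_le.
apply: (@le_trans _ _ (pr P (~` U))); first by rewrite prC//; lra.
apply: le_pr; [exact: measurableC|exact: measurable_all_seen_upto|].
move=> w nU; apply: good_box_seen => k kn; apply: contrapT => /negP bk.
by apply: nU; exists k => //; rewrite mem_iota.
Qed.

End BadProbability.
End Boxes.

(** * Choice of the box size and conclusion *)

Lemma exists_box_size (R : realType) (r e : R) : 0 < r < 1 -> 0 < e ->
  exists2 L, (0 < L)%N & (4 * L)%:R * r ^+ L <= e.
Proof.
move=> /andP[r0 r1] e_gt0.
(* Each of the [m] terms of the geometric sum 1 + r + ... is at least [r ^+ m]. *)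
have mrm m : m%:R * r ^+ m * (1 - r) <= 1 - r ^+ m.
  elim: m => [|m IH]; first by rewrite mul0r mul0r expr0 subrr.
  have : r ^+ m * (1 - r) >= 0 by rewrite mulr_ge0 ?exprn_ge0//; lra.
  have /andP[] : 0 <= r ^+ m <= 1 by rewrite exprn_ge0 ?exprn_ile1//; lra.
  by rewrite exprS -natr1; nra.
have rcvg : r ^+ m @[m --> \oo] --> (0 : R) by apply: cvg_expr; rewrite ger0_norm; lra.
have e'_gt0 : 0 < e * (1 - r) / 8 by rewrite !mulr_gt0//; lra.
have [N _ NP] := cvgr_lt _ rcvg _ e'_gt0.
(* With L = 2m one factor [r ^+ m] absorbs the linear term and the other supplies the smallness. *)
pose m := N.+1; exists (m + m)%N => //.
have rm : r ^+ m < e * (1 - r) / 8 by apply: NP; rewrite /= /m.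
have /andP[rm0 rm1] : 0 <= r ^+ m <= 1 by rewrite exprn_ge0 ?exprn_ile1//; lra.
have mr := mrm m.
rewrite -(ler_pM2r (x := 1 - r)); last lra.
rewrite exprD (_ : (4 * (m + m))%:R = 8 * m%:R :> R); last first.
  by rewrite -natrM; congr _%:R; lia.
rewrite (_ : _ * (1 - r) = 8 * r ^+ m * (m%:R * r ^+ m * (1 - r))); last by ring.
have : 8 * r ^+ m * (m%:R * r ^+ m * (1 - r)) <= 8 * r ^+ m * 1.
  by rewrite ler_wpM2l; lra.
lra.
Qed.

Theorem theorem1 (R : realType) (d : nat) (hd : (2 <= d)%N)
    (p : R) (hp : 0 < p < 1) :
  [/\ (forall (K : int) (v : vertex d), 0 < K ->
         measurable (all_words_seen K v)),
      (exists2 K : int, 0 < K &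
         forall P : probability (Omega d) R, bernoulli_product p P ->
           (0 < P (all_words_seen K (origin d)))%E) &
      (forall K : int, 0 < K ->
         forall P : probability (Omega d) R, bernoulli_product p P ->
           (0 < P (all_words_seen K (origin d)))%E <->
           P (\bigcup_(v in [set: vertex d]) all_words_seen K v) = 1%E)].
Proof.
split.
- by case=> // K v _; exact: measurable_all_words_seen.
- pose i0 : 'I_d := Ordinal (ltnW hd); pose i1 : 'I_d := Ordinal hd.
  have i01 : i0 != i1 by [].
  have r01 : 0 < Num.max p (1 - p) < 1.
    move: hp => /andP[p0 p1]; rewrite lt_max gt_max p0 p1 /=; lra.
  have e_gt0 : 0 < level_bound R 0 by rewrite /level_bound expr1; lra.
  have [L L_gt0 L_large] := exists_box_size r01 e_gt0.
  exists (L + L)%N%:Z => [|P bP]; first by lia.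
  rewrite prE ?lte_fin; last exact: measurable_all_words_seen.
  apply: (@lt_le_trans _ _ 2^-1) => //.
  (* The lower bound 1/2 holds at every finite length, hence in the limit. *)
  apply: (cvgr_to_ge (@cvg_all_seen_upto _ _ _ _ _)); apply: nearW => n.
  exact: (pr_all_seen_upto_ge i01 L_gt0 hp bP L_large).
- case=> // K _ P bP; have d_gt0 := ltnW hd.
  have mA := @measurable_all_words_seen d K (origin d).
  have mU := @measurable_bigcup_all_words_seen d K.
  rewrite prE// prE// lte_fin (all_words_seen_bigcup_iff d_gt0 bP).
  by split=> [->//|[]].
Qed.
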